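(* Let $N$ be a fixed sufficiently large positive integer and $\mathcal P=\mathbb C[y]((x^{-\frac1N}))$. Suppose $(F,G)$ is a Jacobi pair in $\mathcal P$ of the form $$F=x^{\frac m{m+n}}\Big(f+\sum_{i=1}^{M_1}x^{-\frac iN}f_i\Big),\quad f=y^m+\sum_{i=1}^mc_iy^{m-i},\ c_1=0,$$ $$G=x^{\frac n{m+n}}\Big(g+\sum_{i=1}^{M_2}x^{-\frac iN}g_i\Big),\quad g=y^n+\sum_{i=1}^nd_iy^{n-i},$$ with $m,n\in\mathbb N$, $2\le m<n$, $M_1,M_2\in\mathbb Z_+$, $c_i,d_i\in\mathbb C$, $f_i,g_i\in\mathbb C[y]$. Then there exist $$H=x+\sum_{i=1}^\infty x^{1-\frac iN}h_i,\qquad K=y+\sum_{i=1}^\infty x^{-\frac iN}k_i\ \in\mathcal P,\qquad h_i,k_i\in\mathbb C[y],$$ such that $[H,K]=1$ and $$F=H^{\frac m{m+n}}f(K),\qquad G=H^{\frac n{m+n}}g(K).$$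
   Context: $\mathcal P=\mathbb C[y]((x^{-1/N}))$ consists of series $\sum_{i\ge i_0}x^{-i/N}P_i$ with $i_0\in\mathbb Z$, $P_i\in\mathbb C[y]$; $N$ is chosen so large that all elements considered lie in $\mathcal P$ (in particular $\frac{m}{m+n},\frac n{m+n}\in\frac1N\mathbb Z$). The Poisson bracket on $\mathcal P$ is $[P,Q]=(\partial_xP)(\partial_yQ)-(\partial_yP)(\partial_xQ)$. For $H=x(1+\sum_{i\ge1}x^{-i/N}h_i)$ and $a\in\frac1N\mathbb Z$, $H^a=x^a(1+\sum_{i\ge1}x^{-i/N}h_i)^a$ by binomial expansion. Jacobi pair: a pair $(F,G)$ with $[F,G]\in\mathbb C\setminus\{0\}$, $p(F)\ne\pm\infty$ and $p(G)\le p(F)$, where, for an element written as $\sum_{i\ge0}a_iy^{M-i}$ with $a_0\ne0$ and coefficients $a_i$ series in descending rational powers of $x$, the prime degree is the number $p\in\mathbb Q$ with $\deg_xa_i\le\deg_xa_0+pi$ for all $i$ and equality for at least one $i\ge1$ ($-\infty$ if the element equals $a_0y^M$, $+\infty$ if no such $p$ exists otherwise). *)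

(* Defs.v *)
From HB Require Import structures.
From mathcomp Require Import all_boot all_order all_algebra.
From mathcomp Require Import boolp classical_sets functions fsbigop.
From mathcomp Require Import constructive_ereal ereal reals.
From mathcomp Require Export complex.

Set Implicit Arguments.
Unset Strict Implicit.
Unset Printing Implicit Defensive.

Import Order.TTheory GRing.Theory Num.Theory.

Local Open Scope classical_set_scope.
Local Open Scope ring_scope.

(* A series in descending powers of x^(1/N) with coefficients in C[y] is the
   function P : int -> {poly C} whose value P k is the coefficient of x^(-k/N);
   the polynomial variable 'X is y.  The ring C[y]((x^(-1/N))) consists of the
   functions satisfying [laurent].  The addition is the pointwise one, but the
   product is [smul], not the pointwise product of functions. *)

Definition laurent (C : fieldType) (P : int -> {poly C}) : Prop :=
  exists i0 : int, forall k : int, k < i0 -> P k = 0.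

(* x^a p, for a in (1/N) Z; it is 0 if a is not in (1/N) Z *)
Definition xmon (C : fieldType) (N : nat) (a : rat) (p : {poly C}) :
    int -> {poly C} :=
  fun k => if a == - k%:~R / N%:R then p else 0.

(* For series satisfying [laurent] the sum has finite support. *)
Definition smul (C : fieldType) (P Q : int -> {poly C}) : int -> {poly C} :=
  fun k => \sum_(i \in [set: int]) (P i * Q (k - i)).

Definition spow (C : fieldType) (N : nat) (P : int -> {poly C}) (j : nat) :
    int -> {poly C} :=
  iter j (smul P) (xmon N 0 1).

(* f(P), for f with constant coefficients *)
Definition shorner (C : fieldType) (N : nat) (f : {poly C})
    (P : int -> {poly C}) : int -> {poly C} :=
  fun k => \sum_(j < size f) (f`_j *: spow N P j k).

(* Formal sum of the s i for i in I: it is meaningful when each power of x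
   occurs in finitely many of the s i. *)
Definition formal_sum (C : fieldType) (I : set nat)
    (s : nat -> int -> {poly C}) : int -> {poly C} :=
  fun k => \sum_(i \in I) s i k.

Definition gbinom (a : rat) (j : nat) : rat :=
  (\prod_(l < j) (a - l%:R)) / (j`!)%:R.

(* H^a = x^a (1 + u)^a = x^a \sum_j gbinom a j u^j, for a in (1/N) Z and
   H = x (1 + u), where only negative powers of x occur in u *)
Definition rpow (C : fieldType) (N : nat) (H : int -> {poly C}) (a : rat) :
    int -> {poly C} :=
  let u := smul (xmon N (-1) 1) H - xmon N 0 1 in
  smul (xmon N a 1)
       (formal_sum [set: nat] (fun j k => ratr (gbinom a j) *: spow N u j k)).

(* d/dx sends x^(-k/N) to (-k/N) x^(-(k+N)/N). *)
Definition dx (C : fieldType) (N : nat) (P : int -> {poly C}) :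
    int -> {poly C} :=
  fun k => (- (k - N%:Z)%:~R / N%:R) *: P (k - N%:Z).

Definition dy (C : fieldType) (P : int -> {poly C}) : int -> {poly C} :=
  fun k => (P k)^`().

Definition bracket (C : fieldType) (N : nat) (P Q : int -> {poly C}) :
    int -> {poly C} :=
  smul (dx N P) (dy Q) - smul (dy P) (dx N Q).

(* the coefficient of y^j, a series in x alone *)
Definition ycoef (C : fieldType) (P : int -> {poly C}) (j : nat) : int -> C :=
  fun k => (P k)`_j.

(* The supremum is a maximum if a is a nonzero series in descending powers;
   degx N 0 = -oo. *)
Definition degx (C : fieldType) (N : nat) (a : int -> C) : \bar rat :=
  ereal_sup [set ((- k%:~R / N%:R : rat)%:E) | k in [set k : int | a k != 0]].

Definition has_ydeg (C : fieldType) (P : int -> {poly C}) (M : nat) : Prop :=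
  (exists k, ycoef P M k != 0) /\ (forall j k, (M < j)%N -> ycoef P j k = 0).

(* With P = \sum_i a_i y^(M-i), a_i = ycoef P (M - i) *)
Definition is_prime_slope (C : fieldType) (N : nat) (P : int -> {poly C})
    (M : nat) (p : rat) : Prop :=
  (forall i, (i <= M)%N ->
     (degx N (ycoef P (M - i)) <= degx N (ycoef P M) + (p * i%:R)%:E)%E) /\
  (exists i, (1 <= i <= M)%N /\
     degx N (ycoef P (M - i)) = (degx N (ycoef P M) + (p * i%:R)%:E)%E).

Definition is_ymonomial (C : fieldType) (P : int -> {poly C}) (M : nat) :
    Prop :=
  forall j k, j <> M -> ycoef P j k = 0.

(* p is the prime degree of P; a series has at most one prime degree, and none
   if it is 0 or has unbounded degree in y. *)
Definition prime_degree (C : fieldType) (N : nat) (P : int -> {poly C})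
    (p : \bar rat) : Prop :=
  exists M, has_ydeg P M /\
    match p with
    | EFin q => is_prime_slope N P M q
    | -oo%E => is_ymonomial P M
    | +oo%E => ~ is_ymonomial P M /\ forall q, ~ is_prime_slope N P M q
    end.

Definition jacobi_pair (C : fieldType) (N : nat) (F G : int -> {poly C}) :
    Prop :=
  [/\ laurent F /\ laurent G,
      exists2 c : C, c != 0 & bracket N F G = xmon N 0 c%:P
    & exists pF pG : \bar rat,
        [/\ prime_degree N F pF, prime_degree N G pG,
            pF <> +oo%E /\ pF <> -oo%E & (pG <= pF)%E]].

(* Main.v *)
Require Import Defs.
From HB Require Import structures.
From mathcomp Require Import all_boot all_order all_algebra.
From mathcomp Require Import boolp classical_sets functions fsbigop.
From mathcomp Require Import constructive_ereal ereal reals.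
From mathcomp Require Import ring.

(* Put t = x^(-1/N), a = m/(m+n), b = n/(m+n), and write F = x^a P,
   G = x^b Q, H = x E with P, Q, E power series in t over C[y].  As a + b = 1,
   the constant term in t of [F, G] = c is a f g' - b f' g = c, with c <> 0.
   Comparing the coefficients of t^i in P = E^a f(K) and Q = E^b g(K) gives a
   linear system over C[y] for the t^i-coefficients of E and K, whose
   determinant is c: it has a unique solution.  Since E^a E^b = E, the chain
   rule then yields c = [F, G] = c [H, K]. *)

Set Implicit Arguments.
Unset Strict Implicit.
Unset Printing Implicit Defensive.

Import Order.TTheory GRing.Theory Num.Theory.

Local Open Scope classical_set_scope.
Local Open Scope ring_scope.

(** * The ring of formal power series in t over a commutative ring *)

Record pseries (A : comNzRingType) := PSeries { pcoef :> nat -> A }.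

HB.instance Definition _ (A : comNzRingType) := gen_eqMixin (pseries A).
HB.instance Definition _ (A : comNzRingType) := gen_choiceMixin (pseries A).

Section PSeriesRing.
Variable A : comNzRingType.
Implicit Types p q r : pseries A.

Lemma pseriesP p q : p =1 q -> p = q.
Proof. by case: p q => p [q] /= /funext ->. Qed.

Definition psadd p q := PSeries (fun k => p k + q k).
Definition psopp p := PSeries (fun k => - p k).
Definition psmon (i : nat) (a : A) := PSeries (fun k => if k == i then a else 0).
Definition psmul p q := PSeries (fun k => \sum_(i < k.+1) p i * q (k - i)%N).

Definition pstrunc (n : nat) p : {poly A} := \poly_(i < n) p i.

(** Reduces the laws of the series product to those of polynomials: a coefficient of a product
    involves only finitely many coefficients of the factors. *)
Lemma psmul_trunc n p q k : (k < n)%N ->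
  psmul p q k = (pstrunc n p * pstrunc n q)`_k.
Proof.
move=> lt_kn; rewrite coefM; apply: eq_bigr => -[i /= lt_ik] _.
rewrite !coef_poly (leq_ltn_trans _ lt_kn) //.
by rewrite (leq_ltn_trans (leq_subr _ _) lt_kn).
Qed.

Lemma psmulA : associative psmul.
Proof.
move=> p q r; apply: pseriesP => k.
(* The two polynomials differ in general, since only the first is truncated, but they agree up to
   degree [k]. *)
have tM p' q' i : (i < k.+1)%N ->
    (pstrunc k.+1 (psmul p' q'))`_i = (pstrunc k.+1 p' * pstrunc k.+1 q')`_i.
  by move=> lt_ik; rewrite coef_poly lt_ik (psmul_trunc _ _ lt_ik).
rewrite !(@psmul_trunc k.+1) //; transitivity
  (pstrunc k.+1 p * (pstrunc k.+1 q * pstrunc k.+1 r))`_k.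
  by rewrite !coefM; apply: eq_bigr => i _; rewrite tM // ltnS leq_subr.
rewrite mulrA [LHS]coefM [RHS]coefM.
by apply: eq_bigr => i _; rewrite tM.
Qed.

Lemma psmulC : commutative psmul.
Proof.
by move=> p q; apply: pseriesP => k; rewrite !(@psmul_trunc k.+1) // mulrC.
Qed.

Lemma psmul1 : left_id (psmon 0 1) psmul.
Proof.
move=> p; apply: pseriesP => k /=.
rewrite big_ord_recl /= mul1r subn0 big1 ?addr0 // => i _.
by rewrite mul0r.
Qed.

Lemma psmulDl : left_distributive psmul psadd.
Proof.
move=> p q r; apply: pseriesP => k /=; rewrite -big_split /=.
by apply: eq_bigr => i _; rewrite mulrDl.
Qed.

Lemma psmon10 : psmon 0 1 != PSeries (fun=> 0).
Proof.
apply/eqP => /(congr1 (fun p : pseries A => p 0%N)) /eqP.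
by rewrite /= oner_eq0.
Qed.

Lemma psaddA : associative psadd.
Proof. by move=> p q r; apply: pseriesP => k; exact: addrA. Qed.
Lemma psaddC : commutative psadd.
Proof. by move=> p q; apply: pseriesP => k; exact: addrC. Qed.
Lemma psadd0 : left_id (PSeries (fun=> 0)) psadd.
Proof. by move=> p; apply: pseriesP => k; exact: add0r. Qed.
Lemma psaddN : left_inverse (PSeries (fun=> 0)) psopp psadd.
Proof. by move=> p; apply: pseriesP => k; exact: addNr. Qed.

HB.instance Definition _ :=
  GRing.isZmodule.Build (pseries A) psaddA psaddC psadd0 psaddN.
HB.instance Definition _ := GRing.Zmodule_isComNzRing.Build (pseries A)
  psmulA psmulC psmul1 psmulDl psmon10.

Lemma pcoefD p q k : (p + q) k = p k + q k. Proof. by []. Qed.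
Lemma pcoefB p q k : (p - q) k = p k - q k. Proof. by []. Qed.
Lemma pcoefM p q k : (p * q) k = \sum_(i < k.+1) p i * q (k - i)%N.
Proof. by []. Qed.
Lemma pcoefM0 p q : (p * q) 0%N = p 0%N * q 0%N.
Proof. by rewrite pcoefM big_ord1. Qed.
Lemma pcoef_sum I (r : seq I) (P : pred I) (s : I -> pseries A) k :
  (\sum_(i <- r | P i) s i) k = \sum_(i <- r | P i) s i k.
Proof. by elim/big_rec2: _ => // i y1 y2 _ <-. Qed.

Definition cst : A -> pseries A := psmon 0.

Lemma cstE (a : A) k : cst a k = if k == 0%N then a else 0. Proof. by []. Qed.

Lemma pcoef_cstM (a : A) p k : (cst a * p) k = a * p k.
Proof.
rewrite pcoefM big_ord_recl /= subn0 big1 ?addr0 // => i _.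
by rewrite mul0r.
Qed.

Lemma cst_is_zmod : zmod_morphism cst.
Proof.
move=> a b; apply: pseriesP => k; rewrite pcoefB !cstE.
by case: eqP; rewrite ?subr0.
Qed.

Lemma cst_is_monoid : monoid_morphism cst.
Proof.
split=> // a b; apply: pseriesP => k; rewrite pcoef_cstM !cstE.
by case: eqP; rewrite ?mulr0.
Qed.

HB.instance Definition _ :=
  GRing.isZmodMorphism.Build A (pseries A) cst cst_is_zmod.
HB.instance Definition _ :=
  GRing.isMonoidMorphism.Build A (pseries A) cst cst_is_monoid.

Definition eqmod (n : nat) p q := forall k, (k < n)%N -> p k = q k.

Lemma eqmodM n p p' q q' : eqmod n p p' -> eqmod n q q' ->
  eqmod n (p * q) (p' * q').
Proof.
move=> ep eq k lt_kn; rewrite !pcoefM; apply: eq_bigr => -[i /= lt_ik] _.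
by rewrite ep ?eq // ?(leq_ltn_trans (leq_subr _ _) lt_kn) // (leq_trans lt_ik).
Qed.

(** In coefficient [i] of a product, only the two end terms involve coefficients of index [i]; the
    inner terms depend on lower ones and cancel. *)
Lemma pcoef_mulB i p p' q q' : (0 < i)%N -> eqmod i p p' -> eqmod i q q' ->
  (p * q) i - (p' * q') i =
  p 0%N * (q i - q' i) + q 0%N * (p i - p' i).
Proof.
case: i => // i _ ep eq; rewrite !pcoefM.
rewrite !(big_ord_recl i.+1) !(big_ord_recr i) /= subn0 subnn.
rewrite -(ep 0%N) // -(eq 0%N) //.
have -> : \sum_(j < i) p (bump 0 j) * q (i.+1 - bump 0 j)%N =
          \sum_(j < i) p' (bump 0 j) * q' (i.+1 - bump 0 j)%N.
  apply: eq_bigr => -[j /= lt_ji] _; rewrite /bump add1n ep ?eq //.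
  by rewrite subSS ltnS leq_subr.
by rewrite /bump !add1n; ring.
Qed.

Lemma pcoefX_lt p j k : p 0%N = 0 -> (k < j)%N -> (p ^+ j) k = 0.
Proof.
move=> p0; elim: j k => // j IHj k lt_kj.
rewrite exprS pcoefM big1 // => -[[|i] /= lt_ik] _; first by rewrite p0 mul0r.
rewrite IHj ?mulr0 //; case: k lt_ik lt_kj => // k; rewrite subSS !ltnS => _.
by apply: leq_trans; rewrite ltnS leq_subr.
Qed.

End PSeriesRing.

(** * Substitution of series into polynomials over C, and derivations *)

Section Evaluation.
Variable C : numFieldType.
Local Notation S := (pseries {poly C}).
Implicit Types (p q u : S) (f g : {poly C}).

Definition scal (x : C) : S := cst x%:P.
HB.instance Definition _ := GRing.RMorphism.copy scal
  (@cst {poly C} \o @polyC C).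

Lemma pcoef_scalM x p k : (scal x * p) k = x *: p k.
Proof. by rewrite pcoef_cstM mul_polyC. Qed.

Definition ev (u : S) f : S := (map_poly scal f).[u].

Lemma evD u f g : ev u (f + g) = ev u f + ev u g.
Proof. by rewrite /ev rmorphD hornerD. Qed.
Lemma evM u f g : ev u (f * g) = ev u f * ev u g.
Proof. by rewrite /ev rmorphM hornerM. Qed.
Lemma evC u x : ev u x%:P = scal x.
Proof. by rewrite /ev map_polyC hornerC. Qed.
Lemma evX u : ev u 'X = u.
Proof. by rewrite /ev map_polyX hornerX. Qed.
Lemma evZ u x f : ev u (x *: f) = scal x * ev u f.
Proof. by rewrite -mul_polyC evM evC. Qed.
Lemma evB u f g : ev u (f - g) = ev u f - ev u g.
Proof. by rewrite /ev rmorphB hornerD hornerN. Qed.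

Lemma pcoef_ev n u f k : (size f <= n)%N ->
  ev u f k = \sum_(j < n) f`_j *: (u ^+ j) k.
Proof.
move=> le_fn; rewrite /ev (@horner_coef_wide _ n); last first.
  exact: leq_trans (size_poly _ _) le_fn.
rewrite pcoef_sum; apply: eq_bigr => j _.
by rewrite coef_map pcoef_scalM.
Qed.

Lemma pcoef_ev0 u f : ev u f 0%N = f \Po u 0%N.
Proof.
elim/poly_ind: f => [|f c IHf]; first by rewrite comp_poly0 -[0]/0%:P evC.
rewrite evD evM evX evC pcoefD pcoefM0 IHf.
by rewrite comp_polyD comp_polyM comp_polyX comp_polyC.
Qed.

Lemma eqmod_ev n u v f : eqmod n u v -> eqmod n (ev u f) (ev v f).
Proof.
move=> uv; elim/poly_ind: f => [|f c IHf]; first by rewrite -[0]/0%:P !evC.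
rewrite !evD !evM !evX !evC => k lt_kn.
by rewrite !pcoefD; congr (_ + _); apply: eqmodM lt_kn.
Qed.

(** First-order Taylor expansion: [u i] enters coefficient [i] of f(u) linearly, with factor
    f'(u_0). The induction step is the product rule. *)
Lemma pcoef_evB i u v f : (0 < i)%N -> eqmod i u v ->
  ev u f i - ev v f i = (f^`() \Po u 0%N) * (u i - v i).
Proof.
move=> i0 uv; elim/poly_ind: f => [|f c IHf].
  by rewrite -[0]/0%:P !evC derivC comp_poly0 mul0r subrr.
rewrite !evD !evM !evX !evC !pcoefD opprD addrACA subrr addr0.
rewrite pcoef_mulB //; last exact: eqmod_ev.
rewrite IHf pcoef_ev0 derivMXaddC comp_polyD comp_polyM comp_polyX.
by ring.
Qed.

(** Locality allows a series to be replaced by a polynomial expression that agrees with it only up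
    to some power of t. *)
Record derivation (D : S -> S) : Prop := Derivation {
  derivationD : forall p q, D (p + q) = D p + D q;
  derivationM : forall p q, D (p * q) = D p * q + p * D q;
  derivation_scal : forall x, D (scal x) = 0;
  derivation_local : forall k p q, p k = q k -> D p k = D q k }.

Lemma derivation_ev D u f : derivation D -> D (ev u f) = ev u f^`() * D u.
Proof.
case=> DD DM DC _; elim/poly_ind: f => [|f c IHf].
  by rewrite derivC -[0]/0%:P !evC DC rmorph0 mul0r.
rewrite !evD !evM evX evC DD DM DC IHf derivMXaddC evD evM evX.
ring.
Qed.

Definition ydiff p : S := PSeries (fun k => (p k)^`()).

Lemma ydiff_derivation : derivation ydiff.
Proof.
split=> [p q|p q|x|k p q /= -> //]; apply: pseriesP => k.
- exact: derivD.
- rewrite pcoefD [LHS]/= !pcoefM raddf_sum -big_split /=.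
  by apply: eq_bigr => i _; rewrite derivM.
- by case: k => [|k]; rewrite /= ?derivC ?deriv0.
Qed.

(* x d/dx, where t = x^(-1/N) *)
Definition xdiff (N : nat) p : S := PSeries (fun k => (- (k%:R / N%:R)) *: p k).

Lemma xdiff_derivation N : derivation (xdiff N).
Proof.
split=> [p q|p q|x|k p q /= -> //]; apply: pseriesP => k.
- by rewrite /= scalerDr.
- rewrite pcoefD [LHS]/= !pcoefM scaler_sumr -big_split /=.
  apply: eq_bigr => i _; rewrite -scalerAl -scalerAr -scalerDl.
  congr (_ *: _); rewrite -opprD -mulrDl -natrD subnKC //.
  by rewrite -ltnS.
- by case: k => [|k]; rewrite /= ?scaler0 // mul0r oppr0 scale0r.
Qed.

(** * Binomial powers of series with constant term 1 *)

Definition binseries (a : rat) (n : nat) : {poly C} :=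
  \poly_(j < n) ratr (gbinom a j).

(* (1 + u)^a; the truncation is exact if u has no constant term *)
Definition bpow (a : rat) u : S := PSeries (fun k => ev u (binseries a k.+1) k).

(** The powers u^j with j > k are divisible by t^(k+1), so a longer truncation adds nothing to
    coefficient [k]. *)
Lemma pcoef_bpow n a u k : u 0%N = 0 -> (k < n)%N ->
  bpow a u k = ev u (binseries a n) k.
Proof.
move=> u0 lt_kn; rewrite /= !(@pcoef_ev n) ?size_poly //; last first.
  exact: leq_trans (size_poly _ _) lt_kn.
apply: eq_bigr => j _; rewrite !coef_poly ltn_ord.
case: ltnP => // lt_kj; by rewrite pcoefX_lt // !scaler0.
Qed.

Lemma gbinom0 a : gbinom a 0 = 1.
Proof. by rewrite /gbinom big_ord0 fact0 divr1. Qed.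

Lemma gbinomS a j : gbinom a j.+1 *+ j.+1 = (a - j%:R) * gbinom a j.
Proof.
rewrite /gbinom big_ord_recr /= factS natrM invfM.
have nz : (j.+1%:R : rat) != 0 by rewrite pnatr_eq0.
rewrite -[LHS]mulr_natr -[LHS]mulrA (mulrAC j.+1%:R^-1) mulVf // mul1r.
by rewrite mulrAC mulrC.
Qed.

Lemma pcoef_bpow0 a u : u 0%N = 0 -> bpow a u 0%N = 1.
Proof.
move=> u0; rewrite /= (@pcoef_ev 1) ?size_poly // big_ord1 coef_poly /=.
by rewrite gbinom0 rmorph1 scale1r.
Qed.

(** Taylor expansion again: the binomial series has derivative [a] at 0. *)
Lemma pcoef_bpowB i a u v : (0 < i)%N -> u 0%N = 0 -> eqmod i u v ->
  bpow a u i - bpow a v i = ratr a *: (u i - v i).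
Proof.
move=> i0 u0 uv; rewrite /= pcoef_evB // u0.
have -> : (binseries a i.+1)^`() \Po 0 = (ratr a)%:P.
  rewrite comp_poly0r coef_deriv coef_poly.
  rewrite ltnS i0 mulr1n /gbinom big_ord1 subr0 factS fact0 /=.
  by rewrite divr1.
by rewrite mul_polyC.
Qed.

(** The differential equation (1 + X) B' = a B of the binomial series. Differentiation lowers
    degrees by one, so the truncation satisfies it one degree less far. *)
Lemma binseries_ode a n j : (j.+1 < n)%N ->
  ((1 + 'X) * (binseries a n)^`())`_j = (ratr a *: binseries a n)`_j.
Proof.
move=> lt_jn; rewrite mulrDl mul1r coefD coefXM coefZ !coef_deriv !coef_poly.
rewrite lt_jn (ltnW lt_jn) -rmorphMn /= gbinomS.
case: j lt_jn => [|j] lt_jn /=; first by rewrite addr0 subr0 rmorphM.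
rewrite (ltnW lt_jn) -rmorphMn /= -!rmorphD -rmorphM /=.
by congr ratr; rewrite -mulr_natr; ring.
Qed.

(** The logarithmic derivative of (1 + u)^a, multiplied out to avoid division by 1 + u. *)
Lemma derivation_bpow D a u : derivation D -> u 0%N = 0 ->
  (1 + u) * D (bpow a u) = scal (ratr a) * bpow a u * D u.
Proof.
move=> dD u0; apply: pseriesP => k.
(* One term more than coefficient [k] needs, to make up for the degree lost in [binseries_ode]. *)
set B := binseries a k.+2.
have eB : eqmod k.+1 (bpow a u) (ev u B).
  by move=> i lt_ik; apply: pcoef_bpow => //; exact: ltnW.
have eDB : eqmod k.+1 (D (bpow a u)) (D (ev u B)).
  by move=> i lt_ik; apply: (derivation_local dD); exact: eB.
transitivity (((1 + u) * D (ev u B)) k); first by apply: (@eqmodM _ k.+1).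
transitivity ((scal (ratr a) * ev u B * D u) k); last first.
  by apply: (@eqmodM _ k.+1) => //; apply: eqmodM => // i /eB.
rewrite derivation_ev // mulrA; apply: (@eqmodM _ k.+1) => // i lt_ik.
have -> : 1 + u = ev u (1 + 'X) by rewrite evD evX -[1 in RHS]/1%:P evC rmorph1.
(* The difference of the two sides is a polynomial in [u]: its terms of degree at most [i] vanish by
   the differential equation, and higher powers of [u] have no coefficient [i]. *)
rewrite -evM -evZ; set f := _ * _; set g := _ *: _.
apply/eqP; rewrite -subr_eq0 -pcoefB -evB (pcoef_ev _ _ (leqnn _)) big1 // => j _.
have [le_ij|lt_ji] := ltnP i j; first by rewrite pcoefX_lt ?scaler0.
rewrite coefB binseries_ode ?subrr ?scale0r //.
by rewrite !ltnS (leq_trans lt_ji).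
Qed.

(* Both sides have constant term 1 and the same logarithmic derivative. *)
Lemma bpowM N a b u : (0 < N)%N -> a + b = 1 -> u 0%N = 0 ->
  bpow a u * bpow b u = 1 + u.
Proof.
move=> N0 ab u0; set Q := _ * _; set D := xdiff N.
have dD : derivation D := xdiff_derivation N.
have D1 : D (1 + u) = D u.
  by rewrite (derivationD dD) -(rmorph1 scal) (derivation_scal dD) add0r.
have eQ : (1 + u) * D Q = Q * D u.
  rewrite (derivationM dD) mulrDr mulrA (derivation_bpow _ dD u0).
  rewrite [bpow a u * _]mulrC mulrA (derivation_bpow _ dD u0).
  transitivity (scal (ratr (a + b)) * (Q * D u)).
    by rewrite rmorphD rmorphD /Q /=; ring.
  by rewrite ab !rmorph1 mul1r.
(* The difference of two solutions solves the same linear equation. *)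
have eW : (1 + u) * D (Q - (1 + u)) = (Q - (1 + u)) * D u.
  rewrite (derivationD dD) mulrDr eQ mulrBl; congr (_ + _).
  have := derivationD dD (1 + u) (- (1 + u)); rewrite subrr.
  rewrite -(rmorph0 scal) (derivation_scal dD) D1 => /eqP.
  by rewrite eq_sym addrC addr_eq0 => /eqP ->; rewrite mulrN.
have W0 : (Q - (1 + u)) 0%N = 0.
  by rewrite pcoefB pcoefD u0 pcoefM0 !pcoef_bpow0 // addr0 mulr1 subrr.
apply/eqP; rewrite -subr_eq0; apply/eqP; move: (Q - _) eW W0 => W eW W0.
apply: pseriesP; apply: ltn_ind => -[//|k] IHk.
have {IHk} Wlt i : (i <= k)%N -> W i = 0 by exact: IHk.
(* Once the lower coefficients of [W] vanish, the left side is -(k+1)/N times [W k.+1], and the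
   right side is [W k.+1] times the constant term of [D u], which is 0. *)
move/(congr1 (fun p : S => p k.+1)): eW; rewrite !pcoefM.
rewrite big_ord_recl /= big1; last first.
  move=> [i lt_ik] _ /=; rewrite Wlt ?scaler0 ?mulr0 //.
  by rewrite /bump add1n subSS leq_subr.
rewrite [RHS]big_ord_recr /= subnn big1; last first.
  by move=> [i lt_ik] _ /=; rewrite Wlt ?mul0r.
rewrite u0 !addr0 mul1r mul0r oppr0 scale0r mulr0 subn0 => /eqP.
rewrite addr0 scaler_eq0 oppr_eq0 mulf_eq0 invr_eq0 !pnatr_eq0 (gtn_eqF N0).
by move/eqP.
Qed.

End Evaluation.

(** * Recursive solution for the coefficients of H and K, and the chain rule *)

Lemma causal_rec (V : Type) (v0 : V) (G : nat -> (nat -> V) -> V) :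
  exists w : nat -> V,
    forall i, w i = G i (fun j => if (j < i)%N then w j else v0).
Proof.
(* [pref i] tabulates the first [i] values and is [v0] from index [i] on, which makes the recursion
   structural. *)
pose fix pref i : nat -> V := if i is i'.+1 then
  (fun j => if j == i' then G i' (pref i') else pref i' j) else fun=> v0.
exists (fun i => G i (pref i)) => i; congr (G i _).
elim: i => [|i IHi]; apply/funext => j //.
rewrite ltnS leq_eqVlt [LHS]/=; case: eqP => [-> //|_].
exact: (congr1 (@^~ j) IHi).
Qed.

Section JacobianMate.
Variable C : numFieldType.
Local Notation S := (pseries {poly C}).
Implicit Types (p q u K : S) (f g : {poly C}).

(** Gives one row of the linear system: modulo lower coefficients, coefficient [i] of (1 + u)^a f(K)
    is a f u_i + f' K_i, because the constant terms of [u] and [K] are 0 and y. *)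
Lemma pcoef_bpow_evB i a u u' K K' f : (0 < i)%N -> u 0%N = 0 -> K 0%N = 'X ->
    eqmod i u u' -> eqmod i K K' ->
  (bpow a u * ev K f) i - (bpow a u' * ev K' f) i =
  ratr a *: f * (u i - u' i) + f^`() * (K i - K' i).
Proof.
move=> i0 u0 K0 uu' KK'; rewrite pcoef_mulB //; last exact: eqmod_ev.
  rewrite pcoef_bpow0 // pcoef_bpowB // pcoef_evB // pcoef_ev0 K0.
  by rewrite !comp_polyXr mul1r addrC -scalerAr -scalerAl.
by move=> k lt_ki; apply: (eqmod_ev _ uu').
Qed.

(* The coefficients u_i, K_i solve a linear system over C[y] with determinant
   the nonzero constant c. *)
Lemma exists_bpow_ev (a b : rat) (c : C) f g (P Q : S) : c != 0 ->
    ratr a *: (f * g^`()) - ratr b *: (f^`() * g) = c%:P ->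
    P 0%N = f -> Q 0%N = g ->
  exists u K : S, [/\ u 0%N = 0, K 0%N = 'X,
    P = bpow a u * ev K f & Q = bpow b u * ev K g].
Proof.
move=> c0 det_c P0 Q0.
pose U (w : nat -> {poly C} * {poly C}) : S := PSeries (fun k => (w k).1).
pose L (w : nat -> {poly C} * {poly C}) : S := PSeries (fun k => (w k).2).
(* The residuals [r] and [s] become the right-hand sides of the system when [w] vanishes at index
   [i]. *)
pose r w i := P i - (bpow a (U w) * ev (L w) f) i.
pose s w i := Q i - (bpow b (U w) * ev (L w) g) i.
(* Cramer's rule for a f u_i + f' K_i = r_i and b g u_i + g' K_i = s_i. The default (0, 0) leaves
   only lower coefficients in the residuals. *)
have [w wE] := causal_rec (0, 0) (fun i w =>
  if i == 0%N then (0, 'X) else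
  (c^-1 *: (r w i * g^`() - s w i * f^`()),
   c^-1 *: (ratr a *: (f * s w i) - ratr b *: (g * r w i)))).
have w0 : w 0%N = (0, 'X) by rewrite wE.
have U0 : U w 0%N = 0 by rewrite /= w0.
have L0 : L w 0%N = 'X by rewrite /= w0.
pose w' i := fun j => if (j < i.+1)%N then w j else (0, 0).
have eU i : eqmod i.+1 (U w) (U (w' i)) by move=> j /= lt_ji; rewrite /w' lt_ji.
have eL i : eqmod i.+1 (L w) (L (w' i)) by move=> j /= lt_ji; rewrite /w' lt_ji.
(* Separates the unknowns of index [i.+1] from the contribution of the lower ones. *)
have coefS e h i : (bpow e (U w) * ev (L w) h) i.+1 =
    (bpow e (U (w' i)) * ev (L (w' i)) h) i.+1 + (ratr e)%:P * h * (w i.+1).1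
    + h^`() * (w i.+1).2.
  have := pcoef_bpow_evB e h (ltn0Sn i) U0 L0 (eU i) (eL i).
  rewrite [U (w' i) _]/= [L (w' i) _]/= /w' ltnn !subr0 -mul_polyC -addrA => <-.
  by rewrite addrC subrK.
have zc : c^-1%:P * c%:P = 1 :> {poly C} by rewrite -polyCM mulVf.
move: det_c; rewrite -!mul_polyC => det_c.
exists (U w), (L w); split=> //; apply: pseriesP => -[|i].
- by rewrite pcoefM0 pcoef_bpow0 // pcoef_ev0 L0 comp_polyXr mul1r P0.
- rewrite coefS wE /= -/(w' i) -!mul_polyC.
  rewrite -addrA -[P i.+1](subrKC ((bpow a (U (w' i)) * ev (L (w' i)) f) i.+1)).
  (* Multiplying the residual by c^-1 c and writing [c] as the determinant leaves a polynomial
     identity. *)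
  congr (_ + _); rewrite -/(r (w' i) i.+1) -[LHS]mul1r -zc -det_c; ring.
- by rewrite pcoefM0 pcoef_bpow0 // pcoef_ev0 L0 comp_polyXr mul1r Q0.
- rewrite coefS wE /= -/(w' i) -!mul_polyC.
  rewrite -addrA -[Q i.+1](subrKC ((bpow b (U (w' i)) * ev (L (w' i)) g) i.+1)).
  congr (_ + _); rewrite -/(s (w' i) i.+1) -[LHS]mul1r -zc -det_c; ring.
Qed.

(* x^(alpha+beta-1) pbracket alpha beta p q is the Poisson bracket of
   x^alpha p and x^beta q. *)
Definition pbracket (N : nat) (alpha beta : C) p q : S :=
  (scal alpha * p + xdiff N p) * ydiff q - ydiff p * (scal beta * q + xdiff N q).

(** The chain rule [H^a f(K), H^b g(K)] = (a f g' - b f' g)(K) H^(a+b-1) [H, K] for H = x (1 + u).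
    The factor (1 + u)^2 clears the denominators of the two logarithmic derivatives. *)
Lemma pbracket_bpow_ev N (a b : rat) (c : C) u K f g :
    (0 < N)%N -> a + b = 1 -> u 0%N = 0 ->
    ratr a *: (f * g^`()) - ratr b *: (f^`() * g) = c%:P ->
  (1 + u) ^+ 2 *
    pbracket N (ratr a) (ratr b) (bpow a u * ev K f) (bpow b u * ev K g) =
  (1 + u) ^+ 2 * (scal c * pbracket N 1 0 (1 + u) K).
Proof.
move=> N0 ab u0 det_c; set E := 1 + u.
have dX := @xdiff_derivation C N; have dY := @ydiff_derivation C.
have DE D : derivation D -> D E = D u.
  move=> dD; rewrite (derivationD dD) -(rmorph1 (@scal C)).
  by rewrite (derivation_scal dD) add0r.
have DM e h D : derivation D -> E * D (bpow e u * ev K h) =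
    bpow e u * (scal (ratr e) * ev K h * D E + E * ev K h^`() * D K).
  move=> dD; rewrite (derivationM dD) mulrDr mulrA (derivation_bpow _ dD u0).
  by rewrite (derivation_ev _ _ dD) DE //; ring.
have det_ev : scal (ratr a) * ev K f * ev K g^`() -
    scal (ratr b) * ev K f^`() * ev K g = scal c.
  by rewrite -(evC K c) -det_c evB !evZ !evM !mulrA.
have -> : pbracket N 1 0 E K = (E + xdiff N E) * ydiff K - ydiff E * xdiff N K.
  by rewrite /pbracket rmorph1 rmorph0 mul1r mul0r add0r.
rewrite -det_ev /pbracket; set P := bpow a u * _; set Q := bpow b u * _.
(* Each derivative receives one factor [E], as [DM] requires. *)
rewrite [LHS](_ : _ =
  (E * (scal (ratr a) * P) + E * xdiff N P) * (E * ydiff Q) -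
  (E * ydiff P) * (E * (scal (ratr b) * Q) + E * xdiff N Q)); last by ring.
(* One of the two factors [E] is written as (1 + u)^a (1 + u)^b. *)
rewrite [RHS](_ : _ = bpow a u * bpow b u * E *
  ((scal (ratr a) * ev K f * ev K g^`() - scal (ratr b) * ev K f^`() * ev K g) *
   ((E + xdiff N E) * ydiff K - ydiff E * xdiff N K))); last first.
  by rewrite (bpowM N0 ab u0) -/E; ring.
by rewrite /P /Q !(DM _ _ _ dX) !(DM _ _ _ dY); ring.
Qed.

(** Serves to cancel (1 + u)^2: below the first nonzero coefficient of [p] nothing interferes, so
    that coefficient survives in [E * p]. *)
Lemma psreg0 (E p : S) : E 0%N = 1 -> E * p = 0 -> p = 0.
Proof.
move=> E0 Ep0; apply: pseriesP; apply: ltn_ind => k IHk.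
move/(congr1 (fun q : S => q k)): Ep0.
rewrite pcoefM big_ord_recl /= subn0 E0 mul1r big1 ?addr0 // => -[i lt_ik] _ /=.
by rewrite /bump add1n IHk ?mulr0 // ltn_subrL (leq_ltn_trans _ lt_ik).
Qed.

End JacobianMate.

(** * Laurent series in x^(-1/N) as shifted power series in t *)

Section LaurentEncoding.
Variables (C : numFieldType) (N : nat).
Hypothesis N0 : (0 < N)%N.
Local Notation S := (pseries {poly C}).
Implicit Types (p q u : S) (s r : int).

(* x^(-s/N) p, with t = x^(-1/N) *)
Definition xser s p : int -> {poly C} :=
  fun k => if k - s is Posz j then p j else 0.

Lemma xserE s p (j : nat) : xser s p (s + j%:Z) = p j.
Proof. by rewrite /xser [s + _]addrC addrK. Qed.

Lemma xser_lt s p k : k < s -> xser s p k = 0.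
Proof. by rewrite -subr_lt0 /xser; case: (k - s). Qed.

Lemma eq_xser s p (P : int -> {poly C}) :
  (forall k, k < s -> P k = 0) -> (forall j : nat, P (s + j%:Z) = p j) ->
  P = xser s p.
Proof.
move=> Plt Pge; apply/funext => k; have [le_sk|lt_ks] := leP s k.
  have -> : k = s + `|k - s|%N%:Z by rewrite gez0_abs ?subr_ge0 // subrKC.
  by rewrite Pge xserE.
by rewrite Plt // xser_lt.
Qed.

Lemma xser_inj s : injective (xser s).
Proof.
by move=> p q epq; apply: pseriesP => j; rewrite -(xserE s p) epq xserE.
Qed.

Lemma laurent_xser s p : laurent (xser s p).
Proof. by exists s => k /xser_lt. Qed.

Lemma xserD s p q : xser s p + xser s q = xser s (p + q).
Proof.
apply: eq_xser => [k lt_ks|j]; rewrite addrfctE ?xserE //.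
by rewrite !xser_lt // addr0.
Qed.

Lemma xserB s p q : xser s p - xser s q = xser s (p - q).
Proof.
apply: (@addIr _ (xser s q)); by rewrite subrK xserD subrK.
Qed.

Lemma xser_sum s I (t : seq I) (P : pred I) (F : I -> S) :
  \sum_(i <- t | P i) xser s (F i) = xser s (\sum_(i <- t | P i) F i).
Proof.
elim/big_rec2: _ => [|i y1 y2 _ ->]; last exact: xserD.
by apply: eq_xser => [//|j].
Qed.

Lemma exponent_eq (k l : int) :
  ((- k%:~R / N%:R : rat) == - l%:~R / N%:R) = (k == l).
Proof.
have nz : (N%:R : rat)^-1 != 0 by rewrite invr_eq0 pnatr_eq0 -lt0n.
by rewrite (inj_eq (mulIf nz)) eqr_opp eqr_int.
Qed.

Lemma xmon_psmon s (i : nat) (a : rat) (f : {poly C}) :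
  a = - (s + i%:Z)%:~R / N%:R -> xmon N a f = xser s (psmon i f).
Proof.
move=> ->; apply: eq_xser => [k lt_ks|j]; rewrite /xmon exponent_eq.
  by rewrite gt_eqF // (lt_le_trans lt_ks) // lerDl.
by rewrite (inj_eq (addrI s)) eqz_nat eq_sym.
Qed.

Lemma xmon_cst s (a : rat) (f : {poly C}) :
  a = - s%:~R / N%:R -> xmon N a f = xser s (cst f).
Proof. by move=> ->; apply: xmon_psmon; rewrite addr0. Qed.

Lemma xmon01 : xmon N 0 1 = xser 0 1.
Proof. by apply: xmon_cst; rewrite oppr0 mul0r. Qed.

(** Brings H and K into the required form; each power of x occurs in at most one summand. *)
Lemma xser_formal_sum s p (a : rat) : a = - s%:~R / N%:R ->
  xmon N a (p 0%N) +
    formal_sum [set i : nat | (1 <= i)%N] (fun i => xmon N (a - i%:R / N%:R) (p i))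
  = xser s p.
Proof.
move=> aE; have tE i : xmon N (a - i%:R / N%:R) (p i) = xser s (psmon i (p i)).
  by apply: xmon_psmon; rewrite aE rmorphD opprD mulrBl.
rewrite (xmon_cst _ aE).
rewrite (_ : (fun i => _) = fun i => xser s (psmon i (p i))); last first.
  exact/funext.
apply: eq_xser => [k lt_ks|j]; rewrite addrfctE /formal_sum /= ?xserE.
  by rewrite xser_lt // add0r fsbig1 // => i _; rewrite xser_lt.
case: j => [|j].
  rewrite fsbig1 ?addr0 // => i i1.
  have := xserE s (psmon i (p i)) 0; rewrite addr0 => -> /=.
  by case: i i1.
rewrite [cst _ _]/= add0r (@fsbigE _ _ _ _ _ [:: j.+1]) //.
- by rewrite big_cons big_nil mem_set //= addr0 xserE /= eqxx.
- by move=> i; rewrite /= inE => /eqP ->.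
- by move=> i _; rewrite inE xserE /= eq_sym => /negPf ->.
Qed.

(** At index s + r + j only the indices from s to s + j contribute, so the sum over all integers is
    a finite Cauchy product. *)
Lemma smul_xser s r p q : smul (xser s p) (xser r q) = xser (s + r) (p * q).
Proof.
apply: eq_xser => [k lt_k|j]; rewrite /smul.
  apply: fsbig1 => i _; have [le_si|lt_is] := leP s i; last first.
    by rewrite xser_lt // mul0r.
  by rewrite [X in _ * X]xser_lt ?mulr0 // ltrBlDl (lt_le_trans lt_k) // lerD2r.
rewrite (@fsbigE _ _ _ _ _ [seq s + i%:Z | i <- iota 0 j.+1]) //.
- rewrite big_map pcoefM -[iota 0 j.+1]/(index_iota 0 j.+1) big_mkord.
  apply: eq_big => [i|[i /= lt_ij] _]; first by rewrite mem_set.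
  rewrite xserE; congr (_ * _).
  have -> : s + r + j%:Z - (s + i%:Z) = r + (j - i)%N%:Z.
    by rewrite -subzn //; ring.
  by rewrite xserE.
- by rewrite map_inj_uniq ?iota_uniq // => i1 i2 /addrI [].
- move=> i _; have [le_si|lt_is] := leP s i; last by rewrite xser_lt // mul0r.
  have -> : i = s + `|i - s|%N%:Z by rewrite gez0_abs ?subr_ge0 // subrKC.
  move: `|_|%N => l; rewrite (@mem_map _ _ (fun i : nat => s + i%:Z)); last first.
    by move=> i1 i2 /addrI [].
  rewrite mem_iota /= add0n ltnS -ltnNge => lt_jl.
  rewrite [X in _ * X]xser_lt ?mulr0 //.
  rewrite (_ : _ - _ = r + (j%:Z - l%:Z)); last by ring.
  by rewrite gtrDl subr_lt0 ltz_nat.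
Qed.

Lemma spow_xser p j : spow N (xser 0 p) j = xser 0 (p ^+ j).
Proof.
elim: j => [|j IHj]; first exact: xmon01.
by rewrite /spow iterS -/(spow N _ j) IHj smul_xser addr0 exprS.
Qed.

Lemma shorner_xser f p : shorner N f (xser 0 p) = xser 0 (ev p f).
Proof.
apply: eq_xser => [k lt_k|j]; rewrite /shorner.
  by rewrite big1 // => i _; rewrite spow_xser xser_lt // scaler0.
rewrite (pcoef_ev _ _ (leqnn _)); apply: eq_bigr => i _.
by rewrite spow_xser xserE.
Qed.

(** The shift -N stands for the factor x, so the series expanded inside [rpow] is [p - 1]. Its i-th
    power is divisible by t^i, which makes the sum finite in each coefficient. *)
Lemma rpow_xser (a : rat) s p : a = - s%:~R / N%:R -> p 0%N = 1 ->
  rpow N (xser (- N%:Z) p) a = xser s (bpow a (p - 1)).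
Proof.
move=> aE p0; rewrite /rpow.
have -> : smul (xmon N (-1) 1) (xser (- N%:Z) p) - xmon N 0 1 = xser 0 (p - 1).
  rewrite xmon01 (@xmon_cst N%:Z); last first.
    by rewrite mulNr divff // pnatr_eq0 -lt0n.
  by rewrite smul_xser subrr rmorph1 mul1r xserB.
have u0 : (p - 1) 0%N = 0 by rewrite pcoefB p0 subrr.
rewrite (xmon_cst _ aE) rmorph1.
rewrite [formal_sum _ _](_ : _ = xser 0 (bpow a (p - 1))).
  by rewrite smul_xser addr0 mul1r.
apply: eq_xser => [k lt_k|j]; rewrite /formal_sum.
  by apply: fsbig1 => i _; rewrite spow_xser xser_lt // scaler0.
rewrite (@fsbigE _ _ _ _ _ (iota 0 j.+1)) ?iota_uniq //.
  rewrite [RHS](@pcoef_ev _ j.+1) ?size_poly //.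
  rewrite -[iota 0 j.+1]/(index_iota 0 j.+1) big_mkord.
  apply: eq_big => [i|i _]; first by rewrite mem_set.
  by rewrite spow_xser xserE coef_poly ltn_ord.
move=> i _; rewrite mem_iota /= add0n ltnS -ltnNge => lt_ji.
by rewrite spow_xser xserE pcoefX_lt // scaler0.
Qed.

(** Leibniz rule for x d/dx on x^(-s/N) p; the division by x shifts the index by N. *)
Lemma dx_xser s p :
  dx N (xser s p) =
  xser (s + N%:Z) (scal (- s%:~R / N%:R) * p + xdiff N p).
Proof.
apply: eq_xser => [k lt_k|j]; rewrite /dx.
  by rewrite xser_lt ?scaler0 // ltrBlDr.
rewrite pcoefD pcoef_scalM (_ : s + N%:Z + j%:Z - N%:Z = s + j%:Z); last by ring.
by rewrite xserE -scalerDl -mulNr -mulrDl rmorphD opprD.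
Qed.

Lemma dy_xser s p : dy (xser s p) = xser s (ydiff p).
Proof.
by apply: eq_xser => [k lt_k|j]; rewrite /dy ?xserE // xser_lt ?deriv0.
Qed.

(** The condition on the shifts says that the exponents of x add up to 1, so the bracket starts at
    x^0. *)
Lemma bracket_xser s r p q : s + r = - N%:Z ->
  bracket N (xser s p) (xser r q) =
  xser 0 (pbracket N (- s%:~R / N%:R) (- r%:~R / N%:R) p q).
Proof.
move=> sr; rewrite /bracket !dx_xser !dy_xser !smul_xser.
have -> : s + N%:Z + r = 0 by rewrite addrAC sr addNr.
by rewrite [s + (r + _)]addrA sr addNr xserB.
Qed.

Lemma xser_finite (a : rat) s (f : {poly C}) (f_ : nat -> {poly C}) M :
    a = - s%:~R / N%:R ->
  exists2 p : S, p 0%N = f & smul (xmon N a 1)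
    (xmon N 0 f + \sum_(1 <= i < M.+1) xmon N (- (i%:R / N%:R)) (f_ i))
  = xser s p.
Proof.
move=> aE; exists (cst f + \sum_(1 <= i < M.+1) psmon i (f_ i)).
  rewrite pcoefD pcoef_sum big_nat_cond big1 ?addr0 // => i /andP[/andP[i1 _] _].
  by rewrite /= ltn_eqF.
rewrite (xmon_cst _ aE) (@xmon_cst 0); last by rewrite oppr0 mul0r.
rewrite (eq_bigr (fun i => xser 0 (psmon i (f_ i)))); last first.
  by move=> i _; apply: xmon_psmon; rewrite add0r mulNr.
by rewrite xser_sum xserD smul_xser addr0 rmorph1 mul1r.
Qed.

(** Carries the solution of the system and the chain rule over to Laurent series; f and g appear as
    the constant terms of [P] and [Q]. *)
Lemma jacobian_mate (a b : rat) s r (c : C) (P Q : S) :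
    a = - s%:~R / N%:R -> b = - r%:~R / N%:R -> s + r = - N%:Z -> c != 0 ->
    bracket N (xser s P) (xser r Q) = xmon N 0 c%:P ->
  exists E K : S, [/\ E 0%N = 1 /\ K 0%N = 'X,
    bracket N (xser (- N%:Z) E) (xser 0 K) = xmon N 0 1,
    xser s P =
      smul (rpow N (xser (- N%:Z) E) a) (shorner N (P 0%N) (xser 0 K)) &
    xser r Q =
      smul (rpow N (xser (- N%:Z) E) b) (shorner N (Q 0%N) (xser 0 K))].
Proof.
move=> aE bE sr c0.
have ratrE (e : rat) k : e = - k%:~R / N%:R -> ratr e = - k%:~R / N%:R :> C.
  by move=> ->; rewrite fmorph_div rmorphN /= ratr_int ratr_nat.
have nzN : (N%:R : rat) != 0 by rewrite pnatr_eq0 -lt0n.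
have ab : a + b = 1.
  by rewrite aE bE -mulrDl -opprD -rmorphD sr rmorphN opprK divff.
rewrite bracket_xser // -(ratrE _ _ aE) -(ratrE _ _ bE) (@xmon_cst 0); last first.
  by rewrite oppr0 mul0r.
move=> /xser_inj; rewrite -/(scal c) => PQ.
(* Constant terms in t of the bracket: [xdiff] contributes nothing there. *)
have det_c : ratr a *: (P 0%N * (Q 0%N)^`()) - ratr b *: ((P 0%N)^`() * Q 0%N)
    = c%:P.
  move/(congr1 (fun p : S => p 0%N)): PQ; rewrite pcoefB !pcoefM0 !pcoefD.
  rewrite !pcoef_scalM /= mul0r oppr0 !scale0r !addr0 => <-.
  by rewrite scalerAl scalerAr.
have [u [K [u0 K0 PE QE]]] := exists_bpow_ev c0 det_c erefl erefl.
have E0 : (1 + u) 0%N = 1 by rewrite pcoefD u0 addr0.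
(* The chain rule reads (1 + u)^2 c = (1 + u)^2 c [H, K]; [c] is invertible and (1 + u)^2 is
   cancelled by [psreg0]. *)
have EK : pbracket N 1 0 (1 + u) K = 1.
  have := pbracket_bpow_ev K N0 ab u0 det_c; rewrite -PE -QE PQ => eEK.
  have sc0 : scal c * scal c^-1 = 1 by rewrite -rmorphM divff // rmorph1.
  apply/eqP; rewrite -subr_eq0; apply/eqP.
  apply: (@psreg0 _ ((1 + u) ^+ 2)); first by rewrite expr2 pcoefM0 E0 mulr1.
  move: (pbracket N 1 0 (1 + u) K) eEK => B eEK.
  transitivity (scal c * scal c^-1 * ((1 + u) ^+ 2 * (B - 1))).
    by rewrite sc0 mul1r.
  transitivity (scal c^-1 *
    ((1 + u) ^+ 2 * (scal c * B) - (1 + u) ^+ 2 * scal c)); first by ring.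
  by rewrite -eEK subrr mulr0.
exists (1 + u), K; split=> //.
- rewrite bracket_xser ?addr0 // xmon01 rmorphN opprK divff; last first.
    by rewrite pnatr_eq0 -lt0n.
  by rewrite oppr0 mul0r EK.
- rewrite (rpow_xser aE) // shorner_xser smul_xser addr0.
  by rewrite [1 + u]addrC addrK -PE.
- rewrite (rpow_xser bE) // shorner_xser smul_xser addr0.
  by rewrite [1 + u]addrC addrK -QE.
Qed.

End LaurentEncoding.

Theorem theorem4p1 (R : realType) (N m n M1 M2 : nat)
  (c d : nat -> R[i]) (f_ g_ : nat -> {poly R[i]})
  (f g : {poly R[i]}) (F G : int -> {poly R[i]}) :
  (0 < N)%N -> (2 <= m)%N -> (m < n)%N ->
  (* m / (m + n) and n / (m + n) belong to (1 / N) Z *)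
  (m + n %| m * N)%N -> (m + n %| n * N)%N ->
  f = 'X^m + \sum_(1 <= i < m.+1) c i *: 'X^(m - i) ->
  c 1%N = 0 ->
  g = 'X^n + \sum_(1 <= i < n.+1) d i *: 'X^(n - i) ->
  F = smul (xmon N (m%:R / (m + n)%:R) 1)
        (xmon N 0 f + \sum_(1 <= i < M1.+1) xmon N (- (i%:R / N%:R)) (f_ i)) ->
  G = smul (xmon N (n%:R / (m + n)%:R) 1)
        (xmon N 0 g + \sum_(1 <= i < M2.+1) xmon N (- (i%:R / N%:R)) (g_ i)) ->
  jacobi_pair N F G ->
  exists (h k : nat -> {poly R[i]}) (H K : int -> {poly R[i]}),
    [/\ laurent H /\ laurent K,
        H = xmon N 1 1 + formal_sum [set i : nat | (1 <= i)%N]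
                           (fun i => xmon N (1 - i%:R / N%:R) (h i)),
        K = xmon N 0 'X + formal_sum [set i : nat | (1 <= i)%N]
                           (fun i => xmon N (- (i%:R / N%:R)) (k i)),
        bracket N H K = xmon N 0 1
      & F = smul (rpow N H (m%:R / (m + n)%:R)) (shorner N f K) /\
        G = smul (rpow N H (n%:R / (m + n)%:R)) (shorner N g K)].
Proof.
move=> N0 m2 _ /dvdnP[q1 q1E] /dvdnP[q2 q2E] _ _ _ FE GE [_ [c0 c0N0 FG] _].
have mn0 : (0 < m + n)%N by rewrite addn_gt0 (ltnW m2).
have expE (l q : nat) : (l * N = q * (m + n))%N ->
    l%:R / (m + n)%:R = - (- q%:Z)%:~R / N%:R :> rat.
  move=> lq; rewrite rmorphN opprK; apply/eqP.
  by rewrite eqr_div ?pnatr_eq0 -?lt0n // -!natrM lq.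
(* The exponents are q1/N and q2/N, and they add up to 1. *)
have q12 : - q1%:Z - q2%:Z = - N%:Z.
  rewrite -opprD -PoszD; congr (- _%:Z); apply/eqP.
  by rewrite -(eqn_pmul2r mn0) mulnDl -q1E -q2E -mulnDl mulnC.
have aE := expE _ _ q1E; have bE := expE _ _ q2E.
have [P P0 PE] := xser_finite N0 f f_ M1 aE.
have [Q Q0 QE] := xser_finite N0 g g_ M2 bE.
rewrite {}FE {}GE PE QE in FG *.
have [E [K [[E0 K0] EK PEK QEK]]] := jacobian_mate N0 aE bE q12 c0N0 FG.
(* The h_i and k_i are the coefficients of [E] and [K], read as functions on [nat]. *)
exists E, K, (xser (- N%:Z) E), (xser 0 K); split=> //.
- by split; exact: laurent_xser.
- rewrite -E0 (@xser_formal_sum _ _ N0 (- N%:Z)) //.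
  by rewrite rmorphN opprK divff // pnatr_eq0 -lt0n.
- rewrite -K0 -[LHS](@xser_formal_sum _ _ N0 0 _ 0) ?oppr0 ?mul0r //.
  by congr (_ + formal_sum _ _); apply/funext => i; rewrite sub0r.
- by rewrite -P0 -Q0.
Qed.
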